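(* Let $X$ be a Banach space over $\mathbb{K}$. If the pair $(X^*,\mathbb{K})$ has property $\mathbf{L}_{o,p}$, then the pair $(X,\mathbb{K})$ has property $\mathbf{L}_{p,o}$.
   Context: Banach spaces are over $\mathbb{K}$, which is $\mathbb{R}$ or $\mathbb{C}$. $S_X$ denotes the unit sphere of $X$, $X^*$ its topological dual, and $\mathcal{L}(X,Y)$ the space of bounded linear operators from $X$ to $Y$ with the operator norm (so $\mathcal{L}(X,\mathbb{K})=X^*$). A pair $(X,Y)$ of Banach spaces has property $\mathbf{L}_{p,o}$ if for every $\varepsilon>0$ and every $T\in\mathcal{L}(X,Y)$ with $\|T\|=1$ there is $\eta(\varepsilon,T)>0$ such that whenever $x\in S_X$ satisfies $\|T(x)\|>1-\eta(\varepsilon,T)$, there is $S\in\mathcal{L}(X,Y)$ with $\|S\|=1$, $\|S(x)\|=1$ and $\|S-T\|<\varepsilon$. A pair $(X,Y)$ of Banach spaces has property $\mathbf{L}_{o,p}$ if for every $\varepsilon>0$ and every $x\in S_X$ there is $\eta(\varepsilon,x)>0$ such that whenever $T\in\mathcal{L}(X,Y)$ with $\|T\|=1$ satisfies $\|T(x)\|>1-\eta(\varepsilon,x)$, there is $x_0\in S_X$ with $\|T(x_0)\|=1$ and $\|x_0-x\|<\varepsilon$. *)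

(* Defs.v *)
From HB Require Import structures.
From mathcomp Require Import all_boot all_order all_algebra.
From mathcomp Require Import all_classical all_reals.
From mathcomp Require Import topology normedtype.
From mathcomp.real_closed Require Import complex.

Set Implicit Arguments.
Unset Strict Implicit.
Unset Printing Implicit Defensive.

Import Order.TTheory GRing.Theory Num.Theory.
Import numFieldNormedType.Exports.

Local Open Scope classical_set_scope.
Local Open Scope ring_scope.

Variant scalar_kind := RealScalars | ComplexScalars.

Definition scalars (R : realType) (k : scalar_kind) : numFieldType :=
  match k with RealScalars => R | ComplexScalars => R[i] end.

(* Norms of a [normedModType K] take their values in K itself, so for
   K = R[i] the operator norm is a least upper bound in the partial order of
   R[i], all of whose nonnegative elements are real. *)
Lemma scalars_supremum (R : realType) (k : scalar_kind)
    (A : set (scalars R k)) (M : scalars R k) :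
  A !=set0 -> A `<=` [set a | 0 <= a] -> ubound A M -> supremums A !=set0.
Proof.
case: k A M => /= A M A0 Age0 AM.
  have supA : has_sup A by split => //; exists M.
  exists (sup A); split; first exact: sup_upper_bound.
  by move=> u Au; apply: ge_sup.
pose B := [set complex.Re a | a in A].
have realA a : A a -> a = (complex.Re a)%:C%C.
  move=> /Age0 /=; case: a => x y; rewrite lecE /= => /andP[/eqP -> _].
  by [].
have supB : has_sup B.
  split; first by case: A0 => a Aa; exists (complex.Re a), a.
  exists (complex.Re M) => _ [a Aa <-].
  by have := AM _ Aa; rewrite lecE => /andP[].
exists (sup B)%:C%C; split => [a Aa|u Au].
  rewrite (realA _ Aa) lecR; apply: sup_upper_bound => //.
  by exists a.
case: A0 => a Aa.
have uE : u = (complex.Re u)%:C%C.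
  have /Age0 /= := Aa => a0; have := le_trans a0 (Au _ Aa).
  by case: (u) => x y; rewrite lecE /= => /andP[/eqP -> _].
rewrite uE lecR; apply: ge_sup; first by case: supB.
move=> _ [b Ab <-]; by have := Au _ Ab; rewrite lecE => /andP[].
Qed.

Lemma complex_complete (R : realType) (F : set_system (R[i]^o)) :
  ProperFilter F -> cauchy F -> cvg F.
Proof.
move=> FF /cauchy_ballP Fc.
have Fc' (e : R) : 0 < e -> \forall x & y \near F, `|x - y| < e%:C%C.
  by move=> e0; apply: Fc; rewrite ltcR.
have part_cvg (p : R[i] -> R) : (forall x y, p (x - y) = p x - p y) ->
    (forall x, `|p x|%:C%C <= `|x|) -> cvg ((p : R[i] -> R^o) @ F).
  move=> pB pn; apply: cauchy_cvg; apply/cauchy_ballP => e e0.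
  rewrite near_map2; apply: filterS (Fc' e e0) => -[x y] /=.
  move=> xy; rewrite /ball /= -pB -ltcR.
  exact: le_lt_trans (pn _) xy.
have Re_cvg : cvg ((@complex.Re R : R[i] -> R^o) @ F).
  apply: part_cvg => [[? ?] [? ?] //|[x y]]; rewrite normc_def lecR /=.
  by rewrite -sqrtr_sqr ler_wsqrtr// lerDl sqr_ge0.
have Im_cvg : cvg ((@complex.Im R : R[i] -> R^o) @ F).
  apply: part_cvg => [[? ?] [? ?] //|[x y]]; rewrite normc_def lecR /=.
  by rewrite -sqrtr_sqr ler_wsqrtr// lerDr sqr_ge0.
move/cvg_ex: Re_cvg => [/= a Fa]; move/cvg_ex: Im_cvg => [/= b Fb].
apply/cvg_ex; exists (a +i* b)%C.
apply/cvgrPdist_lt => e; case: e => e ei; rewrite ltcE /= => /andP[/eqP-> e0].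
have e20 : 0 < e / 2 by rewrite divr_gt0.
move/cvgrPdist_lt : Fa => /(_ _ e20) Fa.
move/cvgrPdist_lt : Fb => /(_ _ e20) Fb.
near=> z.
have za : `|a - complex.Re z| < e / 2 by near: z.
have zb : `|b - complex.Im z| < e / 2 by near: z.
have -> : (a +i* b)%C - z = ((a - complex.Re z)%:C)%C
    + ((b - complex.Im z)%:C)%C * 'i%C.
  by case: (z) => x y; apply/eqP; rewrite eq_complex /=;
    rewrite !(mulr0, mulr1, mul0r, subr0, addr0, add0r) !eqxx.
apply: le_lt_trans (ler_normD _ _) _.
rewrite normrM !normc_def /= !expr0n /= !addr0 add0r expr1n sqrtr1 mulr1.
rewrite !sqrtr_sqr -rmorphD ltcR (splitr e); exact: ltrD.
Unshelve. all: by end_near. Qed.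

Lemma scalars_complete (R : realType) (k : scalar_kind)
    (F : set_system ((scalars R k)^o)) :
  ProperFilter F -> cauchy F -> cvg F.
Proof. by case: k F => /= F FF; [exact: R_complete|exact: complex_complete]. Qed.

(* K as a Banach space over itself, normed by the modulus. *)
Definition scalar_space (R : realType) (k : scalar_kind) :
    completeNormedModType (scalars R k) :=
  HB.pack ((scalars R k)^o) (Uniform_isComplete.Build ((scalars R k)^o)
    (@scalars_complete R k)).

Section BoundedOperators.
Variables (K : numFieldType) (X Y : normedModType K).

Definition bounded_linear (f : X -> Y) : Prop :=
  linear f /\ exists M : K, forall x, `|f x| <= M * `|x|.

Definition bounded_linear_pred : {pred X -> Y} :=
  fun f => `[< bounded_linear f >].

Record bounded_operator := BoundedOperator {
  bounded_operator_fun :> X -> Y;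
  bounded_operatorP : bounded_operator_fun \in bounded_linear_pred }.

HB.instance Definition _ := [isSub for bounded_operator_fun].
HB.instance Definition _ := [Choice of bounded_operator by <:].

Lemma bounded_linear_submod_closed : submod_closed bounded_linear_pred.
Proof.
split=> [|a f g /asboolP[lf [M fM]] /asboolP[lg [N gN]]]; apply/asboolP; split.
- by move=> b u v; have E x : (0 : X -> Y) x = 0 by []; rewrite !E scaler0 addr0.
- by exists 0 => x; rewrite mul0r normr0.
- move=> b u v; have E x : (a *: f + g) x = a *: f x + g x by [].
  by rewrite !E lf lg !scalerDr !scalerA addrACA (mulrC a b).
- exists (`|a| * M + N) => x; rewrite mulrDl -mulrA.
  apply: le_trans (ler_normD _ _) _; rewrite lerD ?gN// normrZ.
  exact: ler_wpM2l.
Qed.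

HB.instance Definition _ :=
  GRing.isSubmodClosed.Build K (X -> Y) bounded_linear_pred
    bounded_linear_submod_closed.
HB.instance Definition _ :=
  [SubChoice_isSubLmodule of bounded_operator by <:].

Lemma bounded_operator_linear (f : bounded_operator) : linear f.
Proof. by have /asboolP[] := bounded_operatorP f. Qed.

HB.instance Definition _ (f : bounded_operator) :=
  GRing.isLinear.Build K X Y *:%R f (bounded_operator_linear f).

Lemma bounded_operator_bounded (f : bounded_operator) :
  exists M : K, forall x, `|f x| <= M * `|x|.
Proof. by have /asboolP[] := bounded_operatorP f. Qed.

Definition operator_norm (f : bounded_operator) : K :=
  supremum 0 [set `|f x| | x in [set x : X | `|x| <= 1]].

End BoundedOperators.

Section OperatorNorm.
Variables (R : realType) (k : scalar_kind).
Local Notation K := (scalars R k).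

Section Normed.
Variables X Y : normedModType K.
Implicit Types f g : bounded_operator X Y.

Lemma operator_norm_supremums f :
  supremums [set `|f x| | x in [set x : X | `|x| <= 1]] (operator_norm f).
Proof.
rewrite /operator_norm /supremum; case: ifPn => [/eqP f0|_].
  suff : set0 `|f 0| by [].
  by rewrite -f0; exists 0 => //=; rewrite normr0.
have [M fM] := bounded_operator_bounded f.
apply: xgetPex; apply: (@scalars_supremum _ _ _ `|M|).
- by exists `|f 0|, 0 => //=; rewrite normr0.
- by move=> _ [x _ <-] /=.
- move=> _ [x /= x1 <-]; apply: le_trans (fM x) _.
  have Mx0 : 0 <= M * `|x| by exact: le_trans (normr_ge0 (f x)) (fM x).
  by rewrite -(ger0_norm Mx0) normrM normr_id ler_piMr.
Qed.

Lemma operator_norm_ge0 f : 0 <= operator_norm f.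
Proof.
have [ubf _] := operator_norm_supremums f; apply: le_trans (normr_ge0 (f 0)) _.
by apply: ubf; exists 0 => //=; rewrite normr0.
Qed.

Lemma operator_norm_le f (M : K) :
  (forall x, `|x| <= 1 -> `|f x| <= M) -> operator_norm f <= M.
Proof.
move=> fM; have [_] := operator_norm_supremums f.
by apply=> _ [x x1 <-]; exact: fM.
Qed.

Lemma operator_normP f x : `|f x| <= operator_norm f * `|x|.
Proof.
have [->|x0] := eqVneq x 0; first by rewrite linear0 !normr0 mulr0.
have nx0 : 0 < `|x| by rewrite normr_gt0.
rewrite -ler_pdivrMr//; have [+ _] := operator_norm_supremums f.
apply; exists (`|x|^-1 *: x); first by
  rewrite /= normrZ normfV normr_id mulVf ?normr_eq0.
by rewrite linearZ normrZ normfV normr_id mulrC.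
Qed.

Lemma operator_normD f g :
  operator_norm (f + g) <= operator_norm f + operator_norm g.
Proof.
apply: operator_norm_le => x x1; apply: le_trans (ler_normD _ _) _.
by apply: lerD; apply: le_trans (operator_normP _ _) _;
  rewrite ler_piMr ?operator_norm_ge0.
Qed.

Let operator_normZ_le (a : K) f :
  operator_norm (a *: f) <= `|a| * operator_norm f.
Proof.
apply: operator_norm_le => x x1; rewrite [X in `|X|]/(a *: f x) normrZ.
apply: ler_wpM2l => //; apply: le_trans (operator_normP _ _) _.
by rewrite ler_piMr ?operator_norm_ge0.
Qed.

Lemma operator_normZ (a : K) f :
  operator_norm (a *: f) = `|a| * operator_norm f.
Proof.
apply/le_anti; rewrite operator_normZ_le /=.
have [->|a0] := eqVneq a 0; first by rewrite normr0 mul0r operator_norm_ge0.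
rewrite -ler_pdivlMl ?normr_gt0// -normfV -{1}[f]scale1r -(mulVf a0) -scalerA.
exact: operator_normZ_le.
Qed.

Lemma operator_norm0_eq0 f : operator_norm f = 0 -> f = 0.
Proof.
move=> f0; apply/val_inj/funext => x; apply/eqP; rewrite -normr_le0.
by apply: le_trans (operator_normP f x) _; rewrite f0 mul0r.
Qed.

HB.instance Definition _ := Lmodule_isNormed.Build K (bounded_operator X Y)
  operator_normD operator_normZ operator_norm0_eq0.

End Normed.

Section Complete.
Variables (X : normedModType K) (Y : completeNormedModType K).

Lemma bounded_operator_complete (F : set_system (bounded_operator X Y)) :
  ProperFilter F -> cauchy F -> cvg F.
Proof.
move=> FF /cauchy_ballP Fc.
have Fc' (e : K) : 0 < e -> \forall f & g \near F, `|f - g| < e := @Fc e.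
have ev (f g : bounded_operator X Y) x : `|f x - g x| <= `|f - g| * `|x|.
  exact: (operator_normP (f - g)).
have Fx x : cvg ((fun f : bounded_operator X Y => f x) @ F).
  apply: cauchy_cvg; apply/cauchy_ballP => e e0; rewrite near_map2.
  have x1 : 0 < `|x| + 1 by rewrite ltr_wpDl.
  apply: filterS (Fc' (e / (`|x| + 1)) (divr_gt0 e0 x1)) => -[f g] /= fg.
  rewrite -ball_normE /=; apply: le_lt_trans (ev _ _ _) _.
  have [->|x0] := eqVneq x 0; first by rewrite normr0 mulr0.
  rewrite -ltr_pdivlMr ?normr_gt0//; apply: lt_trans fg _.
  by rewrite ltr_pM2l// ltf_pV2 ?posrE ?normr_gt0// ltrDl.
pose g x := lim ((fun f : bounded_operator X Y => f x) @ F).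
have Fg x : (fun f : bounded_operator X Y => f x) @ F --> g x by exact: Fx.
have close (e : K) : 0 < e ->
    \forall f \near F, forall x,
      `|g x - (f : bounded_operator X Y) x| <= e * `|x|.
  move=> e0; near=> f => x.
  have fg : \forall h \near F, `|f - h| < e.
    by near: f; apply: nearP_dep; exact: Fc'.
  have cvgd : (fun h : bounded_operator X Y => `|h x - f x|) @ F -->
      (`|g x - f x| : K^o).
    by apply: cvg_norm; apply: cvgB => //; exact: cvg_cst.
  apply/ler_addgt0Pr => d d0; near F => h.
  rewrite -(subrKA (h x)); apply: le_trans (ler_normD _ _) _.
  rewrite addrC lerD//.
    rewrite distrC; apply: le_trans (ev _ _ _) _; apply: ler_wpM2r => //.
    by apply: ltW; near: h.
  by near: h; move/cvgrPdist_le : (Fg x); apply.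
have g_lin : linear g.
  move=> a u v; apply: cvg_lim => //.
  rewrite (_ : (fun f : bounded_operator X Y => f (a *: u + v)) =
    (fun f : bounded_operator X Y => a *: f u + f v)); last first.
    by apply/funext => f; rewrite linearP.
  by apply: cvgD; [apply: cvgZr; exact: Fg|exact: Fg].
have g_bnd : exists M : K, forall x, `|g x| <= M * `|x|.
  near F => f; exists (1 + `|f|) => x.
  rewrite -(subrK (f x) (g x)) mulrDl; apply: le_trans (ler_normD _ _) _.
  apply: lerD; last exact: operator_normP.
  by move: x; near: f; exact: close.
have gP : g \in @bounded_linear_pred _ X Y by apply/asboolP.
apply/cvg_ex; exists (BoundedOperator gP).
apply/cvgrPdist_le => e e0; near=> f.
apply: operator_norm_le => x x1.
apply: (@le_trans _ _ (e * `|x|)); last by rewrite ler_piMr// ltW.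
by move: x {x1}; near: f; exact: close.
Unshelve. all: by end_near. Qed.

HB.instance Definition _ := Uniform_isComplete.Build (bounded_operator X Y)
  bounded_operator_complete.

End Complete.
End OperatorNorm.

Section Properties.
Variables (R : realType) (k : scalar_kind).
Local Notation K := (scalars R k).

Definition dual (X : completeNormedModType K) : completeNormedModType K :=
  bounded_operator X (scalar_space R k).

(* As norms are K-valued, e and eta range over K; for K = R[i] the condition
   0 < e says that e is a positive real. *)
Definition property_Lpo (X Y : completeNormedModType K) : Prop :=
  forall e : K, 0 < e -> forall T : bounded_operator X Y, `|T| = 1 ->
    exists2 eta : K, 0 < eta &
      forall x : X, `|x| = 1 -> 1 - eta < `|T x| ->
        exists S : bounded_operator X Y,
          [/\ `|S| = 1, `|S x| = 1 & `|S - T| < e].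

Definition property_Lop (X Y : completeNormedModType K) : Prop :=
  forall e : K, 0 < e -> forall x : X, `|x| = 1 ->
    exists2 eta : K, 0 < eta &
      forall T : bounded_operator X Y, `|T| = 1 -> 1 - eta < `|T x| ->
        exists x0 : X, [/\ `|x0| = 1, `|T x0| = 1 & `|x0 - x| < e].

End Properties.

(* Main.v *)
Require Import Defs.
From mathcomp Require Import all_boot all_order all_algebra.
From mathcomp Require Import all_classical all_reals.
From mathcomp Require Import topology normedtype.
From mathcomp.real_closed Require Import complex.

Set Implicit Arguments.
Unset Strict Implicit.
Unset Printing Implicit Defensive.

Import Order.TTheory GRing.Theory Num.Theory.
Import numFieldNormedType.Exports.

Local Open Scope classical_set_scope.
Local Open Scope ring_scope.

(** The point [x] of [X] and the functional [T] of [X^*] play symmetric parts in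
    the number [T x], which is also the value at [T] of the evaluation functional
    of [x] on [X^*].  Property L_(o,p) of [(X^*, K)], taken at the point [T],
    speaks of all norm-one functionals on [X^*] that almost attain their norm
    at [T].  Applied to the evaluation at [x], it moves [T] to a nearby
    norm-one [S] at which the evaluation has modulus one, so that [`|S x| = 1]:
    this is L_(p,o) for [(X, K)], with the same eta.

    The one thing to verify is that the evaluation at a unit vector has norm
    exactly one ([evaluation_isometry]), and this is the Hahn-Banach theorem:
    every [x] has a functional of norm at most one whose value at [x] has
    modulus [`|x|] ([norming_functional]).

    The Hahn-Banach theorem is obtained here without extending functionals from
    subspaces.  By Zorn's lemma there is a minimal sublinear functional below
    any given one.  For [q] sublinear and a direction [x], the infimum over
    [t >= 0] of [q (y + t x) - t q x] is again sublinear in [y], lies below [q],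
    and is at most [- q x] at [- x].  If [q] is minimal this infimum is [q]
    itself, so [q (- x) = - q x] and [q] is linear
    ([minimal_sublinear_real_linear]).  If [q] is arbitrary, a minimal
    functional below the infimum is linear, lies below [q] and agrees with it
    at [x] ([hahn_banach_support]).  Complex scalars are reduced to real ones by
    taking [u y - i u (i y)], where [u] is a real-linear functional supporting
    the norm at [x]. *)

(** * Sublinear functionals and the Hahn-Banach theorem *)

(** The real scalars act on [V] through [iota], so that a complex space is seen
    as a real one while keeping its type: [iota] is the identity in the real
    case and the inclusion of the reals into the complex numbers otherwise. *)
Section SublinearFunctionals.
Variables (R : realType) (K : nzRingType) (iota : {rmorphism R -> K}).
Variable V : lmodType K.
Implicit Types (p q : V -> R) (x y z : V).

(** Positive homogeneity is stated as an inequality, which is what infima of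
    sublinear functionals inherit directly; the equality follows
    ([sublinearZ]). *)
Definition sublinear q : Prop :=
  (forall x y, q (x + y) <= q x + q y) /\
  (forall a x, 0 <= a -> q (iota a *: x) <= a * q x).

Definition real_linear q : Prop :=
  (forall x y, q (x + y) = q x + q y) /\
  (forall a x, q (iota a *: x) = a * q x).

Lemma sublinear0 q : sublinear q -> q 0 = 0.
Proof.
move=> [qD qZ]; apply/le_anti/andP; split.
  by have := qZ 0 0 (lexx 0); rewrite scaler0 mul0r.
by have := qD 0 0; rewrite addr0 lerDl.
Qed.

Lemma sublinearN_ge q y : sublinear q -> - q (- y) <= q y.
Proof.
move=> sq; have [qD _] := sq.
by rewrite -subr_ge0 opprK -(sublinear0 sq) -(subrr y) qD.
Qed.

Lemma sublinearZ q a x : sublinear q -> 0 <= a -> q (iota a *: x) = a * q x.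
Proof.
move=> sq; have [_ qZ] := sq; rewrite le_eqVlt => /predU1P[<-|a0].
  by rewrite rmorph0 scale0r mul0r sublinear0.
apply/le_anti; rewrite qZ ?(ltW a0)//= -ler_pdivlMl//.
have := qZ a^-1 (iota a *: x).
rewrite scalerA -rmorphM mulVf ?gt_eqF// rmorph1 scale1r; apply.
by rewrite invr_ge0 ltW.
Qed.

Definition slide_values q x y : set R :=
  [set q (y + iota t *: x) - t * q x | t in [set t : R | 0 <= t]].

(** The largest sublinear functional below [q] whose value at [- x] is at most
    [- q x]. *)
Definition slide q x y : R := inf (slide_values q x y).

Lemma slide_values_neq0 q x y : slide_values q x y !=set0.
Proof. by exists (q (y + iota 0 *: x) - 0 * q x), 0 => /=. Qed.

(** Since [t * q x = q (t x)], this is subadditivity applied to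
    [t x = (y + t x) - y]; it makes the infimum finite. *)
Lemma slide_values_lbound q x y :
  sublinear q -> lbound (slide_values q x y) (- q (- y)).
Proof.
move=> sq _ [t /= t0 <-]; rewrite -(sublinearZ x sq t0) lerBrDr addrC.
rewrite lerBlDr; have [qD _] := sq.
by have := qD (y + iota t *: x) (- y); rewrite addrAC subrr add0r.
Qed.

Lemma slide_le q x y t : sublinear q -> 0 <= t ->
  slide q x y <= q (y + iota t *: x) - t * q x.
Proof.
move=> sq t0; apply: ge_inf; last by exists t.
by exists (- q (- y)); exact: slide_values_lbound.
Qed.

(** Subadditivity adds the parameters [s] and [t] of the two infima; homogeneity
    rescales the parameter by [a]. *)
Lemma slide_sublinear q x : sublinear q -> sublinear (slide q x).
Proof.
move=> sq; have [qD qZ] := sq; split=> [y z|a y a0].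
  rewrite -lerBlDr; apply: lb_le_inf (slide_values_neq0 _ _ _) _ => _ [s /= s0 <-].
  rewrite lerBlDr -lerBlDl.
  apply: lb_le_inf (slide_values_neq0 _ _ _) _ => _ [t /= t0 <-].
  rewrite lerBlDl; apply: (le_trans (slide_le _ _ sq (addr_ge0 s0 t0))).
  rewrite rmorphD scalerDl [y + z + _]addrACA mulrDl opprD.
  by rewrite [leRHS]addrACA lerD2r.
move: a0; rewrite le_eqVlt => /predU1P[<-|a0].
  rewrite rmorph0 scale0r mul0r; apply: le_trans (slide_le _ _ sq (lexx 0)) _.
  by rewrite rmorph0 scale0r mul0r addr0 subr0 sublinear0.
rewrite -ler_pdivrMl//.
apply: lb_le_inf (slide_values_neq0 _ _ _) _ => _ [t /= t0 <-].
rewrite ler_pdivrMl// mulrBr mulrA -(sublinearZ _ sq (ltW a0)).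
rewrite scalerDr scalerA -rmorphM; apply: slide_le => //.
by rewrite mulr_ge0// ltW.
Qed.

Lemma slide_le_self q x y : sublinear q -> slide q x y <= q y.
Proof.
move=> sq; apply: le_trans (slide_le _ _ sq (lexx 0)) _.
by rewrite rmorph0 scale0r mul0r addr0 subr0.
Qed.

(** The parameter [t = 1] brings the argument back to [- x + x = 0]. *)
Lemma slideN_le q x : sublinear q -> slide q x (- x) <= - q x.
Proof.
move=> sq; apply: le_trans (slide_le _ _ sq ler01) _.
by rewrite rmorph1 scale1r addNr sublinear0// mul1r sub0r.
Qed.

(** Minimality forces [slide q x = q] for every [x], hence [q] is odd; an odd
    subadditive function is additive. *)
Lemma minimal_sublinear_real_linear q : sublinear q ->
  (forall r, sublinear r -> (forall y, r y <= q y) -> r = q) ->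
  real_linear q.
Proof.
move=> sq qmin; have [qD _] := sq.
have qN x : q (- x) = - q x.
  apply/le_anti/andP; split; last first.
    by have := sublinearN_ge (- x) sq; rewrite opprK.
  have {1}<- : slide q x = q.
    by apply: qmin => [|y]; [exact: slide_sublinear|exact: slide_le_self].
  exact: slideN_le.
split=> [x y|a x].
  apply/le_anti; rewrite qD/= -lerBrDr -qN.
  by have := qD (x + y) (- y); rewrite addrK.
have [a0|a0] := leP 0 a; first exact: sublinearZ.
have Na0 : 0 <= - a by rewrite oppr_ge0 ltW.
by rewrite -[a]opprK rmorphN scaleNr qN sublinearZ// !mulNr.
Qed.

(** In Zorn's lemma a chain is bounded by its pointwise infimum.  The infimum is
    finite because every [f] below [p] satisfies [f y >= - f (- y) >= - p (- y)],
    and it is subadditive because any two members of a chain are both above the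
    smaller of them. *)
Lemma exists_minimal_sublinear p : sublinear p ->
  exists q, [/\ sublinear q, forall y, q y <= p y &
    forall r, sublinear r -> (forall y, r y <= q y) -> r = q].
Proof.
move=> sp.
pose T := {q : V -> R | sublinear q /\ forall y, q y <= p y}.
(* Zorn's lemma yields maximal elements, so the order is reversed. *)
pose below (f g : T) := `[< forall y, sval g y <= sval f y >].
have pT : sublinear p /\ forall y, p y <= p y by split.
have [||||[q [sq qp]] qmin] := @Zorn T below.
- by move=> f; apply/asboolP.
- move=> f g h /asboolP fg /asboolP gh; apply/asboolP => y.
  exact: le_trans (gh y) (fg y).
- move=> [f fT] [g gT] /asboolP/= fg /asboolP/= gf; apply: eq_exist.
  by apply/funext => y; apply/le_anti; rewrite fg gf.
- move=> A Atot; have [[f0 Af0]|/forallNP A0] := pselect (A !=set0); last first.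
    by exists (exist _ p pT) => f /A0.
  pose W y := [set sval f y | f in A].
  have W0 y : W y !=set0 by exists (sval f0 y), f0.
  have m_le f y : A f -> inf (W y) <= sval f y.
    move=> Af; apply: ge_inf; last by exists f.
    exists (- p (- y)) => _ [g _ <-]; have [sg gp] := svalP g.
    by apply: le_trans (sublinearN_ge y sg); rewrite lerN2.
  have mT : sublinear (fun y => inf (W y)) /\ forall y, inf (W y) <= p y.
    split; last by move=> y; apply: le_trans (m_le _ _ Af0) _; case: (svalP f0).
    split=> [y z|a y a0].
      rewrite -lerBlDr; apply: lb_le_inf (W0 _) _ => _ [f Af <-].
      rewrite lerBlDr -lerBlDl; apply: lb_le_inf (W0 _) _ => _ [g Ag <-].
      rewrite lerBlDl; have [/asboolP fg|/asboolP gf] := Atot _ _ Af Ag.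
        apply: le_trans (m_le g _ Ag) _; have [[gD _] _] := svalP g.
        by apply: le_trans (gD y z) _; rewrite lerD2r.
      apply: le_trans (m_le f _ Af) _; have [[fD _] _] := svalP f.
      by apply: le_trans (fD y z) _; rewrite lerD2l.
    move: a0; rewrite le_eqVlt => /predU1P[<-|a0].
      rewrite rmorph0 scale0r mul0r; apply: le_trans (m_le _ _ Af0) _.
      by have [sf _] := svalP f0; rewrite sublinear0.
    rewrite -ler_pdivrMl//; apply: lb_le_inf (W0 _) _ => _ [f Af <-].
    rewrite ler_pdivrMl//; apply: le_trans (m_le f _ Af) _.
    by have [[_ fZ] _] := svalP f; apply: fZ; exact: ltW.
  pose m : T := exist _ (fun y => inf (W y)) mT.
  by exists m => f Af; apply/asboolP => y; exact: m_le.
exists q; split=> // r sr rq.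
have rT : sublinear r /\ forall y, r y <= p y.
  by split=> // y; exact: le_trans (rq y) (qp y).
by have /(congr1 sval) := qmin (exist _ r rT) (asboolT rq).
Qed.

(** Minimizing below [slide p x] rather than below [p] is what makes the linear
    functional touch [p] at [x]: its value at [- x] is at most [- p x], so by
    oddness its value at [x] is at least [p x]. *)
Lemma hahn_banach_support p x : sublinear p ->
  exists f, [/\ real_linear f, forall y, f y <= p y & f x = p x].
Proof.
move=> sp.
have [f [sf fp fmin]] := exists_minimal_sublinear (slide_sublinear x sp).
have lf := minimal_sublinear_real_linear sf fmin.
have f_le y : f y <= p y by apply: le_trans (fp y) _; exact: slide_le_self.
exists f; split=> //; apply/le_anti; rewrite f_le/= -lerN2.
have <- : f (- x) = - f x.
  by have := lf.2 (- 1) x; rewrite rmorphN1 scaleN1r mulN1r.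
by apply: le_trans (fp _) _; exact: slideN_le.
Qed.

End SublinearFunctionals.

(** * Norming functionals *)

Lemma real_norming_functional (R : realType) (V : normedModType R) (x : V) :
  exists f : V -> R^o,
    [/\ linear f, forall y, `|f y| <= `|y| & `|f x| = `|x| ].
Proof.
have snorm : sublinear (V := V) idfun (fun y => `|y|).
  split=> [y z|a y a0 /=]; first exact: ler_normD.
  by rewrite normrZ ger0_norm.
have [f [[fD fZ] f_le fx]] := hahn_banach_support x snorm.
exists f; split=> [a y z|y|]; first by rewrite fD fZ.
  rewrite ler_norml f_le andbT lerNl -normrN.
  by have := fZ (- 1) y; rewrite /= scaleN1r mulN1r => <-.
by rewrite fx normr_id.
Qed.

(** The functional is [u y - i u (i y)], where [u] is real-linear, supports the
    norm at [x] and is the real part of the result.  A real part bounded by the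
    norm bounds the modulus, because [y] can be rotated to make the value at [y]
    a nonnegative real. *)
Lemma complex_norming_functional (R : realType) (V : normedModType R[i])
    (x : V) :
  exists f : V -> R[i]^o,
    [/\ linear f, forall y, `|f y| <= `|y| & `|f x| = `|x| ].
Proof.
have normE (W : normedModType R[i]) (y : W) : `|y| = (complex.Re `|y|)%:C%C.
  by have := normr_ge0 y; case: `|y| => a b; rewrite lecE /= => /andP[/eqP -> _].
have snorm : sublinear (V := V) (real_complex R) (fun y => complex.Re `|y|).
  split=> [y z|a y a0].
    by rewrite -lecR rmorphD /= -!normE ler_normD.
  by rewrite -lecR rmorphM /= -!normE normrZ ger0_norm// lecR.
have [u [[uD uZ] u_le ux]] := hahn_banach_support x snorm.
pose f y : R[i]^o := (u y +i* - u ('i%C *: y))%C.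
have u_complex a b y : u ((a +i* b)%C *: y) = a * u y + b * u ('i%C *: y).
  rewrite -uZ -uZ -uD scalerA -scalerDl; congr (u (_ *: _)).
  by apply/eqP; rewrite eq_complex /=; apply/andP; split; apply/eqP;
    rewrite ?(mul0r, mulr0, mulr1, addr0, add0r, subr0).
have f_lin : linear f.
  move=> [a b] y z; apply/eqP; rewrite eq_complex /f /=.
  rewrite scalerDr scalerA !uD (u_complex a b).
  have -> : ('i * (a +i* b) = (- b) +i* a)%C.
    by apply/eqP; rewrite eq_complex /= !(mul0r, mul1r, sub0r, add0r) !eqxx.
  rewrite (u_complex (- b) a) mulrN opprK eqxx /= mulNr !opprD opprK mulrN.
  by rewrite [b * _ - _]addrC.
have f_le y : `|f y| <= `|y|.
  have [fy0|fy0] := eqVneq (f y) 0; first by rewrite fy0 normr0.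
  (* The rotation by [c] makes the value at [c *: y] equal to its modulus. *)
  pose c : R[i] := `|f y| / f y.
  have c1 : `|c| = 1 by rewrite normf_div normr_id divff ?normr_eq0.
  have fcy : f (c *: y) = `|f y|.
    have fZ := f_lin c y 0; have f0 : f 0 = 0.
      by have := f_lin (- 1) 0 0; rewrite scaler0 addr0 scaleN1r addNr.
    by move: fZ; rewrite f0 !addr0 => ->; rewrite /c /GRing.scale /= divfK.
  rewrite (normE _ (f y)) (normE _ y) lecR -fcy /=.
  by apply: le_trans (u_le _) _; rewrite normrZ c1 mul1r.
exists f; split=> //; apply/le_anti; rewrite f_le /= (normE _ x) -ux.
apply: le_trans (normc_ge_Re (f x)).
by rewrite lecR ler_norm.
Qed.

Lemma norming_functional (R : realType) (k : scalar_kind)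
    (X : normedModType (scalars R k)) (x : X) :
  exists f : bounded_operator X (scalar_space R k),
    `|f| <= 1 /\ `|f x| = `|x|.
Proof.
have [f [f_lin f_le fx]] : exists f : X -> scalar_space R k,
    [/\ linear f, forall y, `|f y| <= `|y| & `|f x| = `|x| ].
  case: k X x => X x; first exact: real_norming_functional.
  exact: complex_norming_functional.
have fP : f \in @bounded_linear_pred _ X (scalar_space R k).
  by apply/asboolP; split=> //; exists 1 => y; rewrite mul1r.
exists (BoundedOperator fP); split=> //.
by apply: operator_norm_le => y y1; exact: le_trans (f_le y) y1.
Qed.

(** * The evaluation functionals on the dual *)

Section Evaluation.
Variables (R : realType) (k : scalar_kind).
Variable X : completeNormedModType (scalars R k).

Definition evaluation_fun (x : X) (f : dual X) : scalar_space R k := f x.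

Lemma evaluation_bounded_linear (x : X) :
  evaluation_fun x \in @bounded_linear_pred _ (dual X) (scalar_space R k).
Proof.
apply/asboolP; split=> //; exists `|x| => f.
by rewrite mulrC; exact: operator_normP.
Qed.

Definition evaluation (x : X) :
    bounded_operator (dual X) (scalar_space R k) :=
  BoundedOperator (evaluation_bounded_linear x).

Lemma evaluation_isometry (x : X) : `|evaluation x| = `|x|.
Proof.
apply/le_anti/andP; split.
  apply: operator_norm_le => f f1; apply: le_trans (operator_normP f x) _.
  by rewrite ler_piMl.
have [f [f1 <-]] := norming_functional x.
apply: le_trans (operator_normP (evaluation x) f) _.
by rewrite ler_piMr// operator_norm_ge0.
Qed.

End Evaluation.

Theorem proposition2p3 (R : realType) (k : scalar_kind)
    (X : completeNormedModType (scalars R k)) :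
  property_Lop (dual X) (scalar_space R k) ->
  property_Lpo X (scalar_space R k).
Proof.
move=> Lop e e0 T T1; have [eta eta0 T_near] := Lop e e0 T T1.
exists eta => // x x1 Tx; apply: (T_near (evaluation x)) => //.
by rewrite evaluation_isometry.
Qed.
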